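(* Let $0<\alpha\le\frac12$, $0<s_{\min}<s_{\max}\le1$ and $p_{\max}\in(0,1)$, and define $\mu_0,\lambda_k,k_{\min},k_{\max}$ as in the context. Assume the parameters are such that every value handed to an Any-Fit routine by RPAP is at most $1$ (i.e. $p_{\max}s_{\min}\le\mu_0$ and $\ln\frac{1}{1-p_{\max}}\le\lambda_{k_{\min}}$). Let $X_1,\dots,X_n$ be independent items with $X_i\sim\operatorname{Ber}(p_i,s_i)$, $p_i\in(0,1]$, $0<s_i\le s_{\max}$. If RPAP packs them into $M$ bins and an optimal viable packing uses $OPT$ bins, then $$M\le C\cdot OPT+k_{\max}-k_{\min}+3,\qquad C=\frac{1+\alpha}{(1-\alpha)\mu_{\min}},$$ where $\mu_{\min}=\frac12\min\big(p_{\max},\,\mu_0,\,(1-p_{\max})\lambda_{\min}\big)$ and $\lambda_{\min}=\dfrac{1}{\lfloor 1/s_{\max}\rfloor+1}\,Q^{-1}\!\left(\lfloor 1/s_{\max}\rfloor+1,\,1-\alpha\right)$.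
   Context: $X\sim\operatorname{Ber}(p,s)$ means $X=s$ with probability $p$ and $0$ otherwise. Bins have capacity $1$; an assignment of independent items to bins is viable if for every bin the sum $B$ of its items satisfies $\mathbb{P}(B>1)\le\alpha$; $OPT$ is the minimum number of bins in a viable assignment. For integer $k\ge1$, $Q(k,\lambda)=\mathbb{P}(\operatorname{Poi}(\lambda)\le k-1)$, and for $\beta\in(0,1)$, $Q^{-1}(k,\beta)$ is the unique $\lambda>0$ with $Q(k,\lambda)=\beta$. An Any-Fit routine packs real values in $[0,1]$ one by one into bins of capacity 1, keeping each bin's total at most 1 and opening a new bin only if the current value fits into no open bin of that routine. Algorithm RPAP: set $k_{\min}=\lfloor1/s_{\max}\rfloor$, $k_{\max}=\lceil1/s_{\min}\rceil-1$, $\lambda_k=Q^{-1}(k+1,1-\alpha)$ for $k_{\min}\le k\le k_{\max}$, and $\mu_0=\frac{2\alpha+s_{\min}-\sqrt{s_{\min}^2+4\alpha s_{\min}}}{2\alpha}$. It maintains separate Any-Fit routines (disjoint sets of bins): one for ''confident'' items, one for ''minor'' items, and one for each $k\in\{k_{\min},\dots,k_{\max}\}$. Items are processed online in order: if $p_i>p_{\max}$ the item is packed by the confident routine with value $s_i$; else if $s_i\le s_{\min}$ it is packed by the minor routine with value $p_is_i/\mu_0$; otherwise, with $k=\lfloor1/s_i\rfloor$, it is packed by routine $k$ with value $\ln\!\big(\frac{1}{1-p_i}\big)/\lambda_k$. $M$ is the total number of bins over all routines. *)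

(* Defs.v *)
From mathcomp Require Import all_boot all_order all_algebra.
From mathcomp Require Import all_classical all_reals all_analysis.
Set Implicit Arguments. Unset Strict Implicit. Unset Printing Implicit Defensive.
Import Order.TTheory GRing.Theory Num.Theory.
Local Open Scope ring_scope.

Section Defs.
Variable R : realType.

(* Items are indexed by 'I_n; item i is X_i ~ Ber(p i, s i), all independent.
   The product probability space: outcome S = set of items taking value s i
   (the others take value 0); its probability is
   prod_{i in S} p i * prod_{i notin S} (1 - p i). *)
Definition outcome_prob n (p : 'I_n -> R) (S : {set 'I_n}) : R :=
  (\prod_(i in S) p i) * (\prod_(i in ~: S) (1 - p i)).

Definition bin_load n (s : 'I_n -> R) (f : 'I_n -> nat) (b : nat)
  (S : {set 'I_n}) : R :=
  \sum_(i in S | f i == b) s i.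

Definition overflow_prob n (p s : 'I_n -> R) (f : 'I_n -> nat) (b : nat) : R :=
  \sum_(S : {set 'I_n} | 1 < bin_load s f b S) outcome_prob p S.

Definition viable_assignment n (alpha : R) (p s : 'I_n -> R)
  (m : nat) (f : 'I_n -> nat) : Prop :=
  (forall i, (f i < m)%N) /\ (forall b, (b < m)%N -> overflow_prob p s f b <= alpha).

Definition is_OPT n (alpha : R) (p s : 'I_n -> R) (opt : nat) : Prop :=
  (exists f, viable_assignment alpha p s opt f) /\
  (forall m f, viable_assignment alpha p s m f -> (opt <= m)%N).

(* Q(k, lambda) = P(Poi(lambda) <= k-1). *)
Definition Q (k : nat) (lam : R) : R :=
  \sum_(j < k) expR (- lam) * lam ^+ j / (j`!)%:R.

Definition Qinv (k : nat) (beta : R) : R :=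
  xget 0 [set lam : R | 0 < lam /\ Q k lam = beta].

(* An Any-Fit run on the value sequence v: item j goes to bin (nth 0 a j);
   bins are numbered in order of opening, so before item j the open bins are
   0 .. opened a j - 1. *)
Definition opened (a : seq nat) (j : nat) : nat :=
  \max_(i < j) (nth 0%N a i).+1.

Definition load_before (v : seq R) (a : seq nat) (j b : nat) : R :=
  \sum_(i < j | nth 0%N a i == b) nth 0 v i.

Definition AnyFit (v : seq R) (a : seq nat) (nb : nat) : Prop :=
  [/\ size a = size v,
      (forall j, (j < size v)%N -> (nth 0%N a j <= opened a j)%N),
      (forall j, (j < size v)%N -> nth 0%N a j = opened a j ->
         forall b, (b < opened a j)%N -> 1 < load_before v a j b + nth 0 v j),
      (forall b, load_before v a (size v) b <= 1)
    & nb = opened a (size v)].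

Definition kmin (smax : R) : nat := `| Num.floor (smax^-1) |%N.
Definition kmax (smin : R) : nat := `| Num.ceil (smin^-1) - 1 |%N.
Definition lambda_k (alpha : R) (k : nat) : R := Qinv k.+1 (1 - alpha).
Definition mu0 (alpha smin : R) : R :=
  (2 * alpha + smin - Num.sqrt (smin ^+ 2 + 4 * alpha * smin)) / (2 * alpha).
Definition lambda_min (alpha smax : R) : R :=
  ((kmin smax).+1%:R)^-1 * Qinv (kmin smax).+1 (1 - alpha).
Definition mu_min (alpha smin smax pmax : R) : R :=
  2^-1 * Num.min pmax (Num.min (mu0 alpha smin) ((1 - pmax) * lambda_min alpha smax)).

Definition is_conf n (pmax : R) (p : 'I_n -> R) (i : 'I_n) : bool := pmax < p i.
Definition is_minor n (pmax smin : R) (p s : 'I_n -> R) (i : 'I_n) : bool :=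
  ~~ (pmax < p i) && (s i <= smin).
Definition is_class n (pmax smin : R) (p s : 'I_n -> R) (k : nat) (i : 'I_n) : bool :=
  [&& ~~ (pmax < p i), ~~ (s i <= smin) & Num.floor ((s i)^-1) == k%:Z].

Definition routine_input n (P : pred 'I_n) (g : 'I_n -> R) : seq R :=
  [seq g i | i <- enum 'I_n & P i].

(* RPAP_run ... M : some execution of RPAP (each Any-Fit routine may make any
   Any-Fit choices) uses M bins in total. *)
Definition RPAP_run n (alpha smin smax pmax : R) (p s : 'I_n -> R) (M : nat) : Prop :=
  exists (a_conf a_minor : seq nat) (a_k : nat -> seq nat)
         (nb_conf nb_minor : nat) (nb_k : nat -> nat),
  [/\ AnyFit (routine_input (is_conf pmax p) s) a_conf nb_conf,
      AnyFit (routine_input (is_minor pmax smin p s)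
                (fun i => p i * s i / mu0 alpha smin)) a_minor nb_minor,
      (forall k, (kmin smax <= k <= kmax smin)%N ->
         AnyFit (routine_input (is_class pmax smin p s k)
                   (fun i => ln ((1 - p i)^-1) / lambda_k alpha k)) (a_k k) (nb_k k))
    & M = (nb_conf + nb_minor + \sum_(kmin smax <= k < (kmax smin).+1) nb_k k)%N].

End Defs.

(* Main.v *)
(* Every viable bin has expected load at most (1 + alpha)/(1 - alpha): reveal
   its items one at a time; the load stays at most 1 unless it crosses 1, an
   event of probability at most alpha, and on crossing it is at most 2 with an
   expected remainder no larger than the total mean. Hence the total mean is at
   most OPT (1 + alpha)/(1 - alpha).
   Conversely, any two bins of an Any-Fit routine have joint load above 1, so a
   routine uses at most 2 (sum of its values) + 1 bins, and each value is at
   most p_i s_i / (2 mu_min). For the size classes this rests on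
   Q^-1(k, beta)/k being nondecreasing in k when beta >= 1/2. There
   Q^-1(k, beta)/k <= 1, and Q(k, k x) <= Q(k + 1, (k + 1) x) for x <= 1. *)
Require Import Defs.
From mathcomp Require Import all_boot all_order all_algebra.
From mathcomp Require Import all_classical all_reals all_analysis.
From mathcomp Require Import ring lra zify.
Import Order.TTheory GRing.Theory Num.Theory.
Local Open Scope ring_scope.

(** * Poisson tails and their quantiles *)

Section PoissonQuantile.
Import numFieldNormedType.Exports.
Variable R : realType.
Implicit Types (k : nat) (a b x l : R).

Definition poisson_weight k l : R := expR (- l) * l ^+ k / (k`!)%:R.

Lemma poisson_weight_ge0 k l : 0 <= l -> 0 <= poisson_weight k l.
Proof.
by move=> l0; rewrite !mulr_ge0 ?expR_ge0 ?exprn_ge0 ?invr_ge0 ?ler0n.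
Qed.

Lemma QS k l : Q k.+1 l = Q k l + poisson_weight k l.
Proof. by rewrite /Q big_ord_recr. Qed.

Lemma poisson_weightS k l :
  poisson_weight k.+1 l = poisson_weight k l * (l / k.+1%:R).
Proof.
rewrite /poisson_weight factS natrM exprS invfM; ring.
Qed.

Lemma is_derive_expRN l : is_derive l 1 (fun t : R => expR (- t)) (- expR (- l)).
Proof.
have := @is_derive1_comp R expR -%R l _ _ (is_derive_expR (- l)) _.
move=> /(_ _ (is_deriveNid _ _)); by rewrite mulrN1.
Qed.

(** The derivative telescopes: the weight at [k.+1] has derivative weight at [k] minus weight at
    [k.+1], so only the last weight survives. *)
Lemma is_derive_Q k l : is_derive l 1 (Q k.+1) (- poisson_weight k l).
Proof.
elim: k => [|k IH].
  have -> : Q 1 = (fun t : R => expR (- t)).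
    by apply/funext => t; rewrite /Q big_ord1 expr0 fact0 divr1 mulr1.
  by rewrite /poisson_weight expr0 fact0 divr1 mulr1; exact: is_derive_expRN.
have -> : Q k.+2 = Q k.+1 + ((k.+1)`!%:R^-1 *: ((fun t : R => expR (- t)) * (@id R ^+ k.+1))) :> (R -> R).
  apply/funext => t; rewrite QS /poisson_weight !fctE /= /GRing.scale /=.
  by rewrite mulrC.
have H1 := is_derive_expRN l.
have H2 : is_derive l 1 (@id R) 1 by exact: is_derive_id.
apply: is_derive_eq.
rewrite poisson_weightS /poisson_weight /GRing.scale /= factS natrM invfM !exprS.
rewrite -exprS fctE exprS; field.
by rewrite addrC natr1 !pnatr_eq0 /= -lt0n fact_gt0.
Qed.

Lemma continuous_within_Q k a b : {within `[a, b], continuous (@Q R k.+1)}%classic.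
Proof.
apply: derivable_within_continuous => t _.
exact: (@ex_derive _ _ _ _ _ _ _ (is_derive_Q k t)).
Qed.

Lemma Q_MVT k a b : a < b ->
  exists2 c, a < c < b & Q k.+1 b - Q k.+1 a = - poisson_weight k c * (b - a).
Proof.
move=> ab.
have dQ t : t \in `]a, b[ -> is_derive t 1 (@Q R k.+1) (- poisson_weight k t).
  by move=> _; exact: is_derive_Q.
have [c] := MVT ab dQ (@continuous_within_Q k a b).
by rewrite in_itv /= => cab eqc; exists c.
Qed.

Lemma Q_decreasing k a b : 0 <= a -> a < b -> Q k.+1 b < Q k.+1 a.
Proof.
move=> a0 ab; have [c /andP[ac _] eqc] := Q_MVT k a b ab.
have c0 : 0 < c by lra.
have : 0 < poisson_weight k c * (b - a).
  rewrite mulr_gt0 ?subr_gt0// divr_gt0 ?ltr0n ?fact_gt0//.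
  by rewrite mulr_gt0 ?expR_gt0 ?exprn_gt0.
by move: eqc; rewrite mulNr; lra.
Qed.

Lemma Q_at0 k : @Q R k.+1 0 = 1.
Proof.
rewrite /Q big_ord_recl /= oppr0 expR0 expr0 fact0 divr1 mulr1 big1 ?addr0//.
by move=> i _; rewrite exprS mul0r mulr0 mul0r.
Qed.

Lemma Q_le1 k l : 0 <= l -> Q k.+1 l <= 1.
Proof.
rewrite le_eqVlt => /predU1P[<-|l0]; first by rewrite Q_at0.
by rewrite -(Q_at0 k) ltW// Q_decreasing.
Qed.

(* The weights at k - 1 and k agree, and moving outwards from there the left
   weights decay faster, since (k - m)(k + m) <= k^2. *)
Lemma poisson_weight_reflect k i : (i < k)%N ->
  poisson_weight (k - i.+1) k%:R <= poisson_weight (k + i) k%:R.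
Proof.
elim: i => [|i IH] ik.
  rewrite addn0 subn1 -{3}(prednK ik) poisson_weightS prednK//.
  by rewrite divff ?mulr1// pnatr_eq0 -lt0n.
have {}IH := IH (ltnW ik).
rewrite addnS poisson_weightS.
move: IH; have -> : (k - i.+1 = (k - i.+2).+1)%N by lia.
rewrite poisson_weightS.
have w0 := poisson_weight_ge0 (k - i.+2) k%:R (ler0n _ k).
set w := poisson_weight (k - _) _ in w0 *; set u := poisson_weight (k + i) _.
have k0 : 0 < k%:R :> R by rewrite ltr0n; lia.
have a0 : 0 < (k - i.+2).+1%:R :> R by rewrite ltr0n.
have b0 : 0 < (k + i).+1%:R :> R by rewrite ltr0n.
have ab : (k - i.+2).+1%:R * (k + i).+1%:R <= k%:R * k%:R :> R.
  rewrite -!natrM ler_nat; move: ik; set d := (k - _)%N => ik.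
  have -> : (k = d + i.+2)%N by rewrite /d; lia.
  nia.
move: w u k%:R (k - _).+1%:R (k + i).+1%:R w0 k0 a0 b0 ab => w u K a b w0 k0 a0 b0 ab.
rewrite mulrA ler_pdivrMr// mulrA ler_pdivlMr// => IH.
have u0 : 0 <= u by rewrite -(pmulr_lge0 u a0) (le_trans _ IH)// mulr_ge0// ltW.
rewrite -(ler_pM2r k0) (le_trans (y := u * (a * b)))//; last first.
  by rewrite -[leRHS]mulrA ler_wpM2l.
by rewrite mulrA mulrAC ler_pM2r.
Qed.

(** Reflection maps the first [k] weights injectively to larger ones among the next [k], and all
    [k + k] together have mass at most 1. *)
Lemma Q_diag_le_half k : (0 < k)%N -> Q k k%:R <= 2^-1 :> R.
Proof.
move=> k0; have : Q (k + k) k%:R <= 1 :> R.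
  by case: k k0 => // k _; exact: Q_le1.
rewrite /Q big_split_ord /=.
have : \sum_(i < k) poisson_weight i k%:R <= \sum_(i < k) poisson_weight (k + i) k%:R.
  rewrite (reindex_inj rev_ord_inj)/=; apply: ler_sum => i _.
  exact: poisson_weight_reflect.
rewrite /poisson_weight.
by move: (\sum_(i < k) _) (\sum_(i < k) _) => a b; lra.
Qed.

(* With K = k + 1, the increment of [Q k.+2] from K x to K x + x is - x times a
   weight at an intermediate point c = K x + v x, which is compared with the
   weight at K x using 1 + v/K <= exp (v/K) and x exp (1 - x) <= 1. *)
Lemma Q_scaled_le k x : 0 < x <= 1 -> Q k.+1 (k.+1%:R * x) <= Q k.+2 (k.+2%:R * x).
Proof.
move=> /andP[x0 x1]; set K : R := k.+1%:R.
have K0 : 0 < K by rewrite ltr0n.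
have -> : k.+2%:R * x = K * x + x by rewrite -natr1 mulrDl mul1r.
have [|c /andP[c1 c2]] := Q_MVT k.+1 (K * x) (K * x + x); first by rewrite ltrDl.
rewrite addrAC subrr add0r (QS _ (K * x)).
suff : poisson_weight k.+1 c * x <= poisson_weight k.+1 (K * x) by lra.
pose v := (c - K * x) / x.
have v0 : 0 <= v by rewrite divr_ge0//; lra.
have v1 : v <= 1 by rewrite ler_pdivrMr//; lra.
have cE : c = K * x + v * x by rewrite /v divfK ?gt_eqF//; lra.
have cM : c = K * x * (1 + v / K) by rewrite cE; field; rewrite gt_eqF.
have cX : c ^+ k.+1 <= (K * x) ^+ k.+1 * expR v.
  rewrite cM exprMn ler_pM2l; last by rewrite exprn_gt0// mulr_gt0.
  have {2}-> : v = k.+1%:R * (v / K) by rewrite mulrC divfK// gt_eqF.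
  rewrite expRM_natl lerXn2r ?nnegrE ?expR_ge0 ?expR_ge1Dx//.
  by rewrite addr_ge0// divr_ge0// ltW.
clearbody v.
have xe : expR (- c) * expR v * x <= expR (- (K * x)).
  have -> : - c = - (K * x) + - (v * x) by rewrite cE opprD.
  rewrite expRD -!mulrA -[leRHS]mulr1 ler_pM2l ?expR_gt0// mulrA -expRD.
  (* The exponent is [v * (1 - x)], with [v <= 1] and [0 <= 1 - x]. *)
  have e1 : expR (- (v * x) + v) <= expR (1 - x) by rewrite ler_expR; nra.
  have e2 : x <= expR (x - 1) by have := expR_ge1Dx (x - 1); lra.
  have e3 : expR (1 - x) * expR (x - 1) = 1 by rewrite -expRD addrA subrK subrr expR0.
  by rewrite -e3 ler_pM ?expR_ge0 ?(ltW x0).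
rewrite /poisson_weight mulrAC ler_pM2r; last by rewrite invr_gt0 ltr0n fact_gt0.
have := expR_gt0 (- c).
have : 0 <= (K * x) ^+ k.+1 by rewrite exprn_ge0// mulr_ge0// ltW.
move: cX xe; move: (c ^+ _) ((K * x) ^+ _) (expR (- c)) (expR v) (expR (- (K * x))) => C D E V F cX xe D0 E0.
have : E * C * x <= E * (D * V) * x.
  by apply: ler_wpM2r; [exact: ltW|apply: ler_wpM2l => //; exact: ltW].
nra.
Qed.

Section Quantile.
Variable beta : R.
Hypothesis beta_ge_half : 2^-1 <= beta.
Hypothesis beta_lt1 : beta < 1.

(** The default value of [xget] is ruled out by the intermediate value theorem on [[0, k.+1]]:
    [Q k.+1] is 1 at 0 and at most 1/2, hence at most [beta], at [k.+1]. *)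
Lemma QinvP k : 0 < Qinv k.+1 beta /\ Q k.+1 (Qinv k.+1 beta) = beta.
Proof.
apply: (@xgetPex _ 0 [set l : R | 0 < l /\ Q k.+1 l = beta]%classic).
have k0 : 0 <= k.+1%:R :> R by rewrite ler0n.
have Qk := Q_diag_le_half k.+1 isT.
have [|c] := IVT k0 (@continuous_within_Q k 0 k.+1%:R) (v := beta).
  by rewrite Q_at0 ge_min le_max (le_trans Qk)//= (ltW beta_lt1) orbT.
rewrite in_itv /= => /andP[c0 _] Qc; exists c; split=> //.
rewrite lt_neqAle c0 andbT; apply/eqP => c00; move: Qc.
by rewrite -c00 Q_at0 => b1; move: beta_lt1; rewrite -b1 ltxx.
Qed.

Lemma Q_ge_beta_le_Qinv k l : 0 <= l -> beta <= Q k.+1 l -> l <= Qinv k.+1 beta.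
Proof.
move=> l0 bl; rewrite leNgt; apply/negP => lt.
have [q0 qE] := QinvP k.
by have := Q_decreasing k _ _ (ltW q0) lt; rewrite qE ltNge bl.
Qed.

Lemma Qinv_le k : Qinv k.+1 beta <= k.+1%:R.
Proof.
rewrite leNgt; apply/negP => lt; have [q0 qE] := QinvP k.
have := Q_decreasing k _ _ (ler0n _ _) lt.
by rewrite qE ltNge (le_trans (Q_diag_le_half k.+1 isT)).
Qed.

(** One step suffices. With [x] the ratio at [k], [Q_scaled_le] shows that [Q k.+2] is still at
    least [beta] at [k.+2%:R * x], so this point does not exceed the next quantile. *)
Lemma Qinv_div_nondecreasing j k : (j <= k)%N ->
  Qinv j.+1 beta / j.+1%:R <= Qinv k.+1 beta / k.+1%:R.
Proof.
move=> /subnK<-; elim: (k - j)%N => [//|d]; rewrite addSn.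
move=> /le_trans; apply; move: (d + j)%N => {}k.
have [q0 qE] := QinvP k.
set x := Qinv k.+1 beta / k.+1%:R.
have x01 : 0 < x <= 1.
  by rewrite divr_gt0 ?ltr0n//= ler_pdivrMr ?ltr0n// mul1r Qinv_le.
have := Q_scaled_le k x x01.
have -> : k.+1%:R * x = Qinv k.+1 beta by rewrite mulrC divfK// pnatr_eq0.
rewrite qE => /Q_ge_beta_le_Qinv h.
rewrite ler_pdivlMr ?ltr0n// mulrC; apply: h.
by rewrite mulr_ge0// ltW; case/andP: x01.
Qed.
End Quantile.
End PoissonQuantile.

(** Fibers over distinct keys are disjoint, so no index is counted twice. Applied to the bins of an
    Any-Fit run and to the size classes. *)
Lemma sum_fibers_le (R : realType) (I : finType) (P : pred I) (g : I -> nat)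
  (F : I -> R) (r : seq nat) : uniq r -> (forall i, P i -> 0 <= F i) ->
  \sum_(k <- r) \sum_(i | P i && (g i == k)) F i <= \sum_(i | P i) F i.
Proof.
move=> ur F0; rewrite (exchange_big_dep P)/=; last by move=> k i _ /andP[].
apply: ler_sum => i Pi.
under eq_bigl => k do rewrite Pi eq_sym.
have [ir|/negP ir] := boolP (g i \in r); last first.
  by rewrite big1_seq ?F0// => k /andP[/eqP -> /ir].
by rewrite -big_filter filter_pred1_uniq// big_seq1.
Qed.

(** * Number of bins of an Any-Fit run *)

Section AnyFit.
Variables (R : realType) (v : seq R).
Hypothesis v_ge0 : forall j, 0 <= nth 0 v j.

Lemma openedS a j : opened a j.+1 = maxn (opened a j) (nth 0%N a j).+1.
Proof. by rewrite /opened big_ord_recr. Qed.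

(** Provides the item that opened bin [b]. It exists because the number of open bins grows by at
    most one per item, so no bin number is skipped. *)
Lemma opened_bin a m : (forall j, (j < m)%N -> (nth 0%N a j <= opened a j)%N) ->
  forall b, (b < opened a m)%N ->
  exists2 j, (j < m)%N & opened a j = b /\ nth 0%N a j = b.
Proof.
elim: m => [|m IH] am b; first by rewrite /opened big_ord0.
have {}IH := IH (fun j jm => am j (ltnW jm)).
rewrite openedS leq_max; case: (ltnP b (opened a m)) => [/IH[j jm h] _|bm /= bn].
  by exists j => //; exact: ltnW.
by have := am m (ltnSn m); exists m => //; split; lia.
Qed.

Lemma load_before_le a j m b : (j <= m)%N ->
  load_before v a j b <= load_before v a m b.
Proof.
move=> jm; rewrite /load_before -!(big_mkord (fun i => nth 0%N a i == b) (fun i => nth 0 v i)).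
by rewrite (big_cat_nat (leq0n j) jm)//= lerDl sumr_ge0.
Qed.

Lemma load_before_ge_item a m j : (j < m)%N ->
  nth 0 v j <= load_before v a m (nth 0%N a j).
Proof.
move=> jm; rewrite /load_before (bigD1 (Ordinal jm))//= lerDl.
by rewrite sumr_ge0.
Qed.

(* When bin [c] is opened, its first item does not fit into an older bin [b]. *)
Lemma AnyFit_two_bins a nb b c : AnyFit v a nb -> (b < c < nb)%N ->
  1 < load_before v a (size v) b + load_before v a (size v) c.
Proof.
move=> [_ le_open fits _ ->] /andP[bc cnb].
have [j jm [oj nj]] := opened_bin _ _ le_open _ cnb.
have := fits j jm; rewrite nj oj => /(_ erefl b bc) /lt_le_trans; apply.
rewrite lerD//; first exact/load_before_le/ltnW.
by rewrite -nj; exact: load_before_ge_item.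
Qed.

Lemma AnyFit_bins_le a nb : AnyFit v a nb ->
  nb%:R <= 2 * (\sum_(x <- v) x) + 1.
Proof.
move=> av; pose L b := load_before v a (size v) b.
have L0 b : 0 <= L b by rewrite /L /load_before sumr_ge0.
have sumL : \sum_(b < nb) L b <= \sum_(x <- v) x.
  rewrite (big_nth 0) big_mkord -(big_mkord xpredT L).
  exact: (sum_fibers_le R 'I_(size v) xpredT (fun i => nth 0%N a i)
    (fun i => nth 0 v i) _ (iota_uniq _ _)).
have x0 : 0 <= \sum_(x <- v) x by apply: le_trans sumL; exact: sumr_ge0.
case: nb av sumL => [|nb] av sumL.
  by rewrite addr_ge0// mulr_ge0.
rewrite -natr1 lerD2r.
(* After the case split there are [nb.+1] bins, hence [nb] consecutive pairs; each bin lies in at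
   most two of them. *)
have : \sum_(b < nb) 1 <= \sum_(b < nb) (L b + L b.+1).
  apply: ler_sum => b _; apply/ltW; apply: AnyFit_two_bins av _.
  by rewrite ltnSn ltnS ltn_ord.
rewrite sumr_const card_ord big_split/= => h; apply: le_trans h _.
have h1 : \sum_(b < nb) L b <= \sum_(b < nb.+1) L b by rewrite big_ord_recr lerDl.
have h2 : \sum_(b < nb) L b.+1 <= \sum_(b < nb.+1) L b by rewrite big_ord_recl lerDr.
by lra.
Qed.
End AnyFit.

(** * Expected load of a viable bin *)

Section Items.
Variables (R : realType) (n : nat) (p s : 'I_n -> R).
Hypothesis p01 : forall i, 0 <= p i <= 1.
Hypothesis s01 : forall i, 0 <= s i <= 1.
Implicit Types (A S : {set 'I_n}) (x : 'I_n) (c : R).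

Definition expectation (phi : {set 'I_n} -> R) : R :=
  \sum_(S : {set 'I_n}) outcome_prob p S * phi S.

Lemma outcome_prob_ge0 S : 0 <= outcome_prob p S.
Proof.
by rewrite mulr_ge0// prodr_ge0// => i _; case/andP: (p01 i) => *; lra.
Qed.

Lemma sum_outcome_prob : \sum_S outcome_prob p S = 1.
Proof.
transitivity (\prod_i (p i + (1 - p i))); last first.
  by rewrite big1// => i _; rewrite addrC subrK.
rewrite bigA_distr; apply: eq_big => [S|S _]; first by rewrite inE.
rewrite [RHS](bigID (mem S))/=; congr (_ * _).
  by apply: eq_bigr => i ->.
by apply: eq_big => i; rewrite inE // => /negbTE ->.
Qed.

(** Conditioning on item [x], by independence. Forcing [x] in or out of [S] keeps the right side an
    expectation over the same outcome space. *)
Lemma expectation_cond x phi : expectation phi =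
  expectation (fun S => p x * phi (x |: S) + (1 - p x) * phi (S :\ x)).
Proof.
(* For [S] avoiding [x], [w S] is the probability that the other items realize [S]. Pairing [S] with
   [x |: S] reduces both sides to sums over such [S]. *)
pose w (S : {set 'I_n}) := (\prod_(i in S) p i) * (\prod_(i in ~: S :\ x) (1 - p i)).
have split psi : expectation psi =
    \sum_(S : {set 'I_n} | x \notin S) w S * (p x * psi (x |: S) + (1 - p x) * psi S).
  rewrite /expectation (bigID (fun S : {set _} => x \in S))/=.
  rewrite (reindex_onto (fun S => x |: S) (fun S => S :\ x))/=; last first.
    by move=> S xS; rewrite finset.setD1K.
  rewrite [X in X + _](eq_bigl (fun S : {set 'I_n} => x \notin S)); last first.
    move=> S; rewrite finset.setU11/=; apply/eqP/idP => [<-|xS]; first by rewrite finset.setD11.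
    by rewrite finset.setU1K.
  rewrite -big_split/=; apply: eq_bigr => S xS.
  have -> : outcome_prob p S = (1 - p x) * w S.
    rewrite /outcome_prob (big_setD1 x (A := ~: S)) ?inE//= /w; ring.
  have -> : outcome_prob p (x |: S) = p x * w S.
    rewrite /outcome_prob big_setU1//= finset.setCU /w finset.setIC -finset.setDE; ring.
  ring.
rewrite [LHS]split [RHS]split; apply: eq_bigr => S xS.
have -> : x |: (x |: S) = x |: S by rewrite finset.setUA finset.setUid.
have -> : (x |: S) :\ x = S by rewrite finset.setU1K.
have -> : S :\ x = S by apply/finset.setDidPl; rewrite disjoint_sym disjoints1.
by ring.
Qed.

Definition load (A S : {set 'I_n}) : R := \sum_(i in S :&: A) s i.

(** [c] stands for the load already revealed, [A] for the items still hidden. *)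
Definition prob_exceed (A : {set 'I_n}) (c : R) : R :=
  expectation (fun S => (1 < c + load A S)%R%:R).

Definition mean_load (A : {set 'I_n}) : R := \sum_(i in A) p i * s i.

Lemma load_ge0 A S : 0 <= load A S.
Proof. by rewrite sumr_ge0// => i _; case/andP: (s01 i). Qed.

Lemma mean_load_ge0 A : 0 <= mean_load A.
Proof.
rewrite sumr_ge0// => i _.
by rewrite mulr_ge0//; [case/andP: (p01 i)|case/andP: (s01 i)].
Qed.

Lemma prob_exceed_ge0 A c : 0 <= prob_exceed A c.
Proof. by rewrite sumr_ge0// => S _; rewrite mulr_ge0 ?outcome_prob_ge0. Qed.

Lemma prob_exceed_gt1 A c : 1 < c -> prob_exceed A c = 1.
Proof.
move=> c1; rewrite -sum_outcome_prob; apply: eq_bigr => S _.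
by rewrite (lt_le_trans c1) ?mulr1// lerDl load_ge0.
Qed.

Lemma prob_exceed_setU1 A c x : x \notin A ->
  prob_exceed (x |: A) c =
  p x * prob_exceed A (c + s x) + (1 - p x) * prob_exceed A c.
Proof.
move=> xA; rewrite {1}/prob_exceed (expectation_cond x).
rewrite /prob_exceed /expectation 2!big_distrr -big_split/=; apply: eq_bigr => S _.
have -> : load (x |: A) (x |: S) = s x + load A S.
  by rewrite /load -finset.setUIr big_setU1// inE (negbTE xA) andbF.
have -> : load (x |: A) (S :\ x) = load A S.
  rewrite /load; apply: eq_bigl => i; rewrite !inE.
  by case: eqVneq => [->|]; rewrite ?(negbTE xA) ?andbF.
rewrite addrA; ring.
Qed.

(* Revealing the items one at a time, once the load exceeds 1 (it is then at
   most 2) the remaining items add at most [mean_load A] on average. *)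
Lemma mean_load_le_exceed A c : c <= 1 ->
  c + mean_load A <= 1 + prob_exceed A c * (1 + mean_load A).
Proof.
have [m] := ubnP #|A|; elim: m A c => // m IH A c Am c1.
have [->|[x xA]] := finset.set_0Vmem A.
  rewrite {1}/mean_load big_set0 addr0 (le_trans c1)// lerDl.
  by rewrite mulr_ge0 ?prob_exceed_ge0// addr_ge0// mean_load_ge0.
have xB : x \notin A :\ x by rewrite finset.setD11.
rewrite -(finset.setD1K xA) prob_exceed_setU1//.
have Bm : (#|A :\ x| < m)%N by move: Am; rewrite (cardsD1 x A) xA.
set B := A :\ x in xB Bm *.
have -> : mean_load (x |: B) = p x * s x + mean_load B by rewrite /mean_load big_setU1.
have E0 := mean_load_ge0 B; have P0 := prob_exceed_ge0 B c.
have P1 := prob_exceed_ge0 B (c + s x).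
have := IH B c Bm c1.
have : c + s x + mean_load B <= 1 + prob_exceed B (c + s x) * (1 + mean_load B).
  have [cs|cs] := leP (c + s x) 1; first exact: IH.
  by rewrite prob_exceed_gt1//; case/andP: (s01 x) => *; lra.
case/andP: (p01 x) => px0 px1; case/andP: (s01 x) => sx0 _.
have q0 : 0 <= 1 - p x by lra.
move: (mean_load B) (prob_exceed B c) (prob_exceed B (c + s x)) E0 P0 P1 => E P0 P1 E0 P0ge P1ge.
move=> /(ler_wpM2l px0) h1 /(ler_wpM2l q0) h0.
(* The sum of [h1] and [h0] has the factor [1 + E] where the goal has [1 + p x * s x + E]; this term
   is the difference. *)
have : 0 <= (p x * P1 + (1 - p x) * P0) * (p x * s x).
  by rewrite mulr_ge0 ?addr_ge0 ?mulr_ge0.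
by lra.
Qed.

Lemma overflow_probE (f : 'I_n -> nat) b :
  overflow_prob p s f b = prob_exceed [set i | f i == b] 0.
Proof.
rewrite /overflow_prob /prob_exceed /expectation big_mkcond/=.
apply: eq_bigr => S _; rewrite add0r.
have -> : load [set i | f i == b] S = bin_load s f b S.
  by apply: eq_bigl => i; rewrite !inE.
by case: ifP; rewrite ?mulr1 ?mulr0.
Qed.

(** Starting from revealed load 0, the mean [E] of a viable bin satisfies
    [E <= 1 + alpha * (1 + E)]. Solve for [E] and sum over the bins. *)
Lemma viable_mean_le alpha m (f : 'I_n -> nat) : 0 <= alpha -> alpha < 1 ->
  viable_assignment alpha p s m f ->
  \sum_i p i * s i <= (1 + alpha) / (1 - alpha) * m%:R.
Proof.
move=> a0 a1 [fm viab].
rewrite (partition_big (fun i => Ordinal (fm i)) xpredT)//=.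
rewrite mulrC -[X in X%:R]card_ord -sum1_card natr_sum mulr_suml.
apply: ler_sum => b _; rewrite mul1r.
have := viab b (ltn_ord b); rewrite overflow_probE.
have := mean_load_le_exceed [set i | f i == b] 0 ler01.
have -> : \sum_(i | Ordinal (fm i) == b) p i * s i = mean_load [set i | f i == b].
  by apply: eq_bigl => i; rewrite inE.
have := mean_load_ge0 [set i | f i == b].
have := prob_exceed_ge0 [set i | f i == b] 0.
move: (mean_load _) (prob_exceed _ _) => E P P0 E0 h1 h2.
rewrite ler_pdivlMr ?subr_gt0//.
have : P * (1 + E) <= alpha * (1 + E) by rewrite ler_wpM2r// addr_ge0.
by lra.
Qed.
End Items.

(** * Charging the bins of each routine to the mean load *)

Section Routines.
Variables (R : realType) (n : nat).

(** [m] is the exchange rate between packed value and mean load; [F i] will be [p i * s i]. *)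
Lemma routine_bins_le (P : pred 'I_n) (g F : 'I_n -> R) m a nb : 0 < m ->
  (forall i, P i -> 0 <= g i) -> (forall i, P i -> m * g i <= F i) ->
  AnyFit (routine_input P g) a nb ->
  nb%:R <= 2 / m * (\sum_(i | P i) F i) + 1.
Proof.
move=> m0 g0 gF /AnyFit_bins_le h; apply: le_trans (h _) _.
  move=> j; have [jm|jm] := ltnP j (size (routine_input P g)); last by rewrite nth_default.
  have /mapP[i] := mem_nth 0 jm.
  by rewrite mem_filter => /andP[Pi _] ->; exact: g0.
rewrite lerD2r /routine_input big_map big_filter big_enum_cond/=.
rewrite -mulrA ler_pM2l// ler_pdivlMl// mulr_sumr.
by apply: ler_sum => i /gF.
Qed.

Variables (alpha smin smax pmax : R) (p s : 'I_n -> R).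
Hypothesis alpha01 : 0 < alpha <= 2^-1.
Hypothesis smin0 : 0 < smin.
Hypothesis smin_lt_smax : smin < smax.
Hypothesis pmax01 : 0 < pmax < 1.
Hypothesis p01 : forall i, 0 < p i <= 1.
Hypothesis s01 : forall i, 0 < s i <= smax.

Let beta_ge_half : 2^-1 <= 1 - alpha.
Proof. by case/andP: alpha01 => *; lra. Qed.

Let beta_lt1 : 1 - alpha < 1.
Proof. by case/andP: alpha01 => *; lra. Qed.

Let smax0 : 0 < smax. Proof. exact: lt_trans smin_lt_smax. Qed.

Let ps_ge0 i : 0 <= p i * s i.
Proof. by case/andP: (p01 i) => *; case/andP: (s01 i) => *; rewrite mulr_ge0 ?ltW. Qed.

Lemma lambda_min_gt0 : 0 < lambda_min alpha smax.
Proof.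
rewrite mulr_gt0 ?invr_gt0 ?ltr0n//.
by have [] := QinvP _ _ beta_ge_half beta_lt1 (kmin smax).
Qed.

(** The floor of [smax^-1] is an integer strictly below [smin^-1], hence at most its ceiling minus
    1. This makes the natural-number count of classes a true difference. *)
Lemma kmin_le_kmax : (kmin smax <= kmax smin)%N.
Proof.
have lt1 : smax^-1 < smin^-1 by rewrite ltf_pV2.
have f0 : 0 <= Num.floor smax^-1 by rewrite floor_ge_int invr_ge0 ltW.
have fc : Num.floor smax^-1 <= Num.ceil smin^-1 - 1.
  rewrite -ltzD1 subrK ceil_gt_int.
  exact: le_lt_trans (floor_le _) lt1.
by rewrite -lez_nat /kmin /kmax !gez0_abs// (le_trans f0).
Qed.

Lemma kmin_le_class k i : is_class pmax smin p s k i -> (kmin smax <= k)%N.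
Proof.
case/and3P => _ _ /eqP fk; case/andP: (s01 i) => si0 si1.
rewrite -lez_nat /kmin gez0_abs ?floor_ge_int ?invr_ge0 ?(ltW smax0)// -fk.
by apply: le_floor; rewrite lef_pV2.
Qed.

Lemma class_size_gt k i : is_class pmax smin p s k i -> 1 <= k.+1%:R * s i.
Proof.
case/and3P => _ _ /eqP fk; case/andP: (s01 i) => si0 si1.
have := floorD1_gt (s i)^-1; rewrite fk intrD -natr1 => /ltW h.
by rewrite -ler_pdivrMr// mul1r.
Qed.

(** Two estimates are multiplied: [ln (1 + y) <= y] at [y = p i / (1 - p i)] bounds the logarithm,
    and [lambda_min] is at most [lambda_k] divided by [k.+1], hence at most [lambda_k * s i]. *)
Lemma class_value_le k i : is_class pmax smin p s k i ->
  0 <= ln ((1 - p i)^-1) / lambda_k alpha k /\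
  (1 - pmax) * lambda_min alpha smax * (ln ((1 - p i)^-1) / lambda_k alpha k)
    <= p i * s i.
Proof.
move=> ki; have sk := class_size_gt _ _ ki; have kk := kmin_le_class _ _ ki.
have pi : p i <= pmax by case/and3P: ki; rewrite -leNgt.
case/andP: pmax01 => pm0 pm1; case/andP: (p01 i) => pi0 _; case/andP: (s01 i) => si0 _.
have q0 : 0 < 1 - p i by lra.
have [l0 _] := QinvP _ _ beta_ge_half beta_lt1 k.
have := Qinv_div_nondecreasing _ _ beta_ge_half beta_lt1 _ _ kk.
rewrite mulrC -/(lambda_min alpha smax) -/(lambda_k alpha k) => lk.
rewrite -/(lambda_k alpha k) in l0.
have ln_ge : 0 <= ln ((1 - p i)^-1) by rewrite ln_ge0// invf_ge1//; lra.
have ln_le : (1 - pmax) * ln ((1 - p i)^-1) <= p i.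
  have : ln ((1 - p i)^-1) <= p i / (1 - p i).
    have -> : ln (1 - p i)^-1 = ln (1 + p i / (1 - p i)).
      by congr ln; field; rewrite gt_eqF.
    by rewrite le_ln1Dx// (lt_le_trans (ltrN10 _))// divr_ge0 ?ltW.
  rewrite ler_pdivlMr// mulrC; apply: le_trans.
  by rewrite ler_wpM2r//; lra.
split; first by rewrite divr_ge0// ltW.
have lks : lambda_min alpha smax <= lambda_k alpha k * s i.
  by apply: le_trans lk _; rewrite ler_pM2l// -[leLHS]mulr1 ler_pdivrMl ?ltr0n//.
rewrite mulrA ler_pdivrMr// mulrAC.
rewrite -[leRHS]mulrA [s i * _]mulrC; apply: ler_pM => //; last exact/ltW/lambda_min_gt0.
by rewrite mulr_ge0// subr_ge0 ltW.
Qed.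

Lemma sum_routines_le :
  \sum_(i | is_conf pmax p i) p i * s i
  + \sum_(i | is_minor pmax smin p s i) p i * s i
  + \sum_(kmin smax <= k < (kmax smin).+1)
      \sum_(i | is_class pmax smin p s k i) p i * s i
  <= \sum_i p i * s i.
Proof.
rewrite [leRHS](bigID (is_conf pmax p))/= -addrA lerD2l.
rewrite [leRHS](bigID (fun i => s i <= smin))/= lerD2l.
(* The floor is nonnegative, so its absolute value is a natural-number key whose fibers are the
   classes. *)
under eq_bigr => k _.
  under eq_bigl => i.
    have -> : is_class pmax smin p s k i =
        (~~ is_conf pmax p i && ~~ (s i <= smin)) && (`|Num.floor (s i)^-1|%N == k).
      rewrite /is_class -andbA -eqz_nat gez0_abs// floor_ge_int invr_ge0 ltW//.
      by case/andP: (s01 i).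
    over.
  over.
by apply: sum_fibers_le => //; exact: iota_uniq.
Qed.

Lemma RPAP_bins_le M : 0 < mu0 alpha smin ->
  RPAP_run alpha smin smax pmax p s M ->
  M%:R <= (mu_min alpha smin smax pmax)^-1 * (\sum_i p i * s i)
          + (kmax smin)%:R - (kmin smax)%:R + 3.
Proof.
move=> mu0_gt0 [a_conf [a_minor [a_k [nbc [nbm [nbk [conf minor cls ->]]]]]]].
(* Doubling removes the factor 1/2 from [mu_min]; it comes back as the 2 of the Any-Fit bound. *)
pose m := 2 * mu_min alpha smin smax pmax.
have mE : m = Num.min pmax (Num.min (mu0 alpha smin) ((1 - pmax) * lambda_min alpha smax)).
  by rewrite /m /mu_min mulrA divff ?mul1r// pnatr_eq0.
case/andP: (pmax01) => pm0 pm1.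
have m0 : 0 < m by rewrite mE !lt_min pm0 mu0_gt0 mulr_gt0 ?subr_gt0 ?lambda_min_gt0.
have m1 : m <= pmax by rewrite mE ge_min lexx.
have m2 : m <= mu0 alpha smin by rewrite mE !ge_min lexx orbT.
have m3 : m <= (1 - pmax) * lambda_min alpha smax by rewrite mE !ge_min lexx !orbT.
have -> : (mu_min alpha smin smax pmax)^-1 = 2 / m.
  by rewrite /m [in RHS]invfM mulrA divff ?mul1r// pnatr_eq0.
(* Confident items have [m <= pmax < p i]; for minor items [m <= mu0] cancels the division by
   [mu0]. *)
have hc : nbc%:R <= 2 / m * (\sum_(i | is_conf pmax p i) p i * s i) + 1.
  apply: (routine_bins_le _ _ _ _ _ _ m0 _ _ conf) => i ci; case/andP: (s01 i) => si0 _.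
    exact: ltW.
  by rewrite ler_pM2r// (le_trans m1)// ltW.
have hm : nbm%:R <= 2 / m * (\sum_(i | is_minor pmax smin p s i) p i * s i) + 1.
  apply: (routine_bins_le _ _ _ _ _ _ m0 _ _ minor) => i _.
    by rewrite divr_ge0// ltW.
  by rewrite mulrA ler_pdivrMr// mulrC ler_wpM2l.
have hk k : (kmin smax <= k < (kmax smin).+1)%N ->
    (nbk k)%:R <= 2 / m * (\sum_(i | is_class pmax smin p s k i) p i * s i) + 1.
  move=> /cls; apply: routine_bins_le => // i /class_value_le[v0 vle] //.
  by apply: le_trans vle; rewrite ler_wpM2r.
(* Each of the [kmax - kmin + 1] classes costs one extra bin; the confident and minor routines bring
   the constant to 3. *)
have hsum : (\sum_(kmin smax <= k < (kmax smin).+1) nbk k)%N%:R <=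
    2 / m * (\sum_(kmin smax <= k < (kmax smin).+1)
      \sum_(i | is_class pmax smin p s k i) p i * s i)
    + ((kmax smin)%:R + 1 - (kmin smax)%:R).
  rewrite natr1 -natrB ?(leq_trans kmin_le_kmax)// -[(_ - _)%N]muln1 -sum_nat_const_nat.
  rewrite !natr_sum mulr_sumr -big_split/= big_nat_cond [leRHS]big_nat_cond.
  by apply: ler_sum => k; rewrite andbT => /hk.
have /(ler_wpM2l (ltW (divr_gt0 (ltr0Sn R 1) m0))) := sum_routines_le.
rewrite !natrD !mulrDr.
by move: hc hm hsum; lra.
Qed.
End Routines.

(** * Combining both bounds through the total mean load *)

Theorem theorem1 (R : realType) (alpha smin smax pmax : R) (n : nat)
  (p s : 'I_n -> R) (M OPT : nat) :
  0 < alpha -> alpha <= 2^-1 ->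
  0 < smin -> smin < smax -> smax <= 1 ->
  0 < pmax -> pmax < 1 ->
  pmax * smin <= mu0 alpha smin ->
  ln ((1 - pmax)^-1) <= lambda_k alpha (kmin smax) ->
  (forall i, 0 < p i <= 1) ->
  (forall i, 0 < s i <= smax) ->
  RPAP_run alpha smin smax pmax p s M ->
  is_OPT alpha p s OPT ->
  M%:R <= (1 + alpha) / ((1 - alpha) * mu_min alpha smin smax pmax) * OPT%:R
          + (kmax smin)%:R - (kmin smax)%:R + 3.
Proof.
move=> a0 a1 smin0 smin_smax smax1 pm0 pm1 mu0_ge _ p01 s01 run [[f viab] _].
(* Positivity of [mu0] is read off from the assumption that bounds the minor values by 1. *)
have mu0_gt0 : 0 < mu0 alpha smin by apply: lt_le_trans mu0_ge; exact: mulr_gt0.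
have a01 : 0 < alpha <= 2^-1 by rewrite a0.
have pm01 : 0 < pmax < 1 by rewrite pm0.
apply: le_trans (RPAP_bins_le _ _ _ _ _ _ _ _ a01 smin0 smin_smax pm01 p01 s01 _ mu0_gt0 run) _.
rewrite 2!lerD2r lerD2r.
have p01' i : 0 <= p i <= 1 by case/andP: (p01 i) => /ltW -> ->.
have s01' i : 0 <= s i <= 1.
  by case/andP: (s01 i) => /ltW -> /= /le_trans; exact.
have al1 : alpha < 1 by lra.
have h := viable_mean_le _ _ _ _ p01' s01' _ _ _ (ltW a0) al1 viab.
have mu_gt0 : 0 < mu_min alpha smin smax pmax.
  by rewrite mulr_gt0 ?invr_gt0// !lt_min pm0 mu0_gt0 mulr_gt0 ?subr_gt0 ?lambda_min_gt0.
move: (mu_min _ _ _ _) mu_gt0 => mu mu_gt0.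
by rewrite invfM mulrA mulrAC [leRHS]mulrC ler_pM2l ?invr_gt0.
Qed.
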